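(* Let $N^{2m}(J,h)$ be an almost para-Hermitian manifold, let $M_1^{2n_1+1}(\phi_1,\xi_1,\eta_1,g_1)$ be a para-Sasakian manifold, and let $f:N^{2m}\to M_1^{2n_1+1}$ be a $(J,\phi_1)$-paraholomorphic map. Then the tension field of $f$ satisfies $\tau(f)\in\Gamma(D_1)$, i.e. $\tau(f)$ takes values in the distribution $D_1$ along $f$.
   Context: An almost para-Hermitian manifold $N^{2m}(J,h)$ is a smooth $2m$-dimensional manifold with a $(1,1)$-tensor field $J$ satisfying $J^2=Id$, whose eigenbundles for the eigenvalues $\pm1$ have the same rank, and a pseudo-Riemannian metric $h$ with $h(JX,Y)=-h(X,JY)$ for all vector fields $X,Y$ (so $h$ has signature $(m,m)$). An almost paracontact metric manifold $M^{2n+1}(\phi,\xi,\eta,g)$ is a smooth $(2n+1)$-dimensional manifold with a $(1,1)$-tensor field $\phi$, a vector field $\xi$ and a $1$-form $\eta$ such that $\phi^2=Id-\eta\otimes\xi$, $\eta(\xi)=1$, the eigendistributions of $\phi|_{\ker\eta}$ for the eigenvalues $\pm1$ both have dimension $n$, together with a pseudo-Riemannian metric $g$ of signature $(n+1,n)$ with $g(\phi X,\phi Y)=-g(X,Y)+\eta(X)\eta(Y)$ for all vector fields $X,Y$. (Consequently $\phi\xi=0$, $\eta\circ\phi=0$, $g(X,\xi)=\eta(X)$, $g(\phi X,Y)=-g(X,\phi Y)$.) It is para-Sasakian if $(\nabla_X\phi)Y=-g(X,Y)\xi+\eta(Y)X$ for all vector fields $X,Y$, where $\nabla$ is the Levi-Civita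 connection of $g$. For the para-Sasakian manifold $M_1^{2n_1+1}$, $D_1=\ker\eta_1$ is the distribution of rank $2n_1$, so $TM_1=D_1\oplus\{\xi_1\}$, where $\{\xi_1\}$ is the line distribution spanned by $\xi_1$. A smooth map $f:N^{2m}\to M_1^{2n_1+1}$ is $(J,\phi_1)$-paraholomorphic if $f_*\circ J=\phi_1\circ f_*$. For a smooth map $f:(P,g_P)\to(Q,g_Q)$ between pseudo-Riemannian manifolds with Levi-Civita connections $\nabla$ and $\overline\nabla$, the second fundamental form of $f$ is $\alpha_f(X,Y)=\widetilde\nabla_X f_*Y-f_*\nabla_XY$ for $X,Y\in\Gamma(TP)$, where $\widetilde\nabla$ is the pullback of $\overline\nabla$ to $f^{-1}(TQ)$. The tension field is $\tau(f)=Tr_{g_P}\alpha_f\in\Gamma(f^{-1}(TQ))$, i.e. $\tau(f)=\sum_i\epsilon_i\alpha_f(e_i,e_i)$ for a local orthonormal frame $\{e_i\}$ with $\epsilon_i=g_P(e_i,e_i)=\pm1$. *)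

(* Defs.v *)
From HB Require Import structures.
From mathcomp Require Import all_boot all_order all_algebra.
From mathcomp Require Import all_classical all_reals all_analysis.

Set Implicit Arguments.
Unset Strict Implicit.
Unset Printing Implicit Defensive.

Import Order.TTheory GRing.Theory Num.Theory.
Import numFieldNormedType.Exports.

Local Open Scope classical_set_scope.
Local Open Scope ring_scope.

(* C^oo on an open set A: every iterated directional derivative exists and is
   (Frechet) differentiable at every point of A. *)
Definition smooth_rV (R : realType) (n : nat) (V : normedModType R)
    (A : set 'rV[R]_n) (F : 'rV[R]_n -> V) : Prop :=
  forall (vs : seq 'rV[R]_n) (x : 'rV[R]_n), A x ->
    differentiable (foldr (fun v G => 'D_v G) F vs) x.

Record chart (R : realType) (n : nat) (T : topologicalType) := Chart {
  chart_dom : set T;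
  chart_fun :> T -> 'rV[R]_n;
  (* meaningful on the image of chart_dom only *)
  chart_inv : 'rV[R]_n -> T;
  chart_dom_open : open chart_dom;
  chart_im_open : open (chart_fun @` chart_dom);
  chart_funK : {in chart_dom, cancel chart_fun chart_inv};
  chart_continuous : {within chart_dom, continuous chart_fun};
  chart_inv_continuous :
    {within chart_fun @` chart_dom, continuous chart_inv}
}.

(* The atlas need not be maximal. A chart [chart_at p] around each point [p]
   is singled out: it serves to write tangent vectors at [p] in coordinates. *)
Record manifold (R : realType) (n : nat) := Manifold {
  mfd_carrier :> topologicalType;
  mfd_hausdorff : hausdorff_space mfd_carrier;
  mfd_second_countable : @second_countable mfd_carrier;
  atlas : set (chart R n mfd_carrier);
  chart_at : mfd_carrier -> chart R n mfd_carrier;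
  chart_at_atlas : forall p, atlas (chart_at p);
  chart_at_dom : forall p, chart_dom (chart_at p) p;
  atlas_smooth : forall c d, atlas c -> atlas d ->
    smooth_rV (c @` (chart_dom c `&` chart_dom d)) (d \o chart_inv c)
}.

(* A tangent vector at [p] is the row vector of its components in the
   coordinate basis of the chart [chart_at p]; thus T_p M is 'rV[R]_n, a vector
   field is a function X : M -> 'rV[R]_n (X p in T_p M), and a vector field
   along f : P -> M is a function V : P -> 'rV[R]_n (V q in T_(f q) M).
   Note that the basis changes with the point; smoothness of fields is read off
   their components in a fixed chart, see [smooth_along].
   - A (1,1)-tensor field is J : M -> 'M[R]_n acting on the right,
     (J X) p = X p *m J p.
   - A 1-form is eta : M -> 'cV[R]_n, see [form1].
   - A field of bilinear forms is g : M -> 'M[R]_n, see [form2]. *)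

(* The derivative v(u) of a function u along v in T_p M. *)
Definition dir (R : realType) (n : nat) (M : manifold R n)
    (V : normedModType R) (p : M) (v : 'rV[R]_n) (u : M -> V) : V :=
  'D_v (u \o chart_inv (chart_at p)) (chart_at p p).

Definition smooth_fun (R : realType) (n : nat) (M : manifold R n)
    (V : normedModType R) (U : set M) (u : M -> V) : Prop :=
  forall c, @atlas R n M c ->
    smooth_rV (c @` (U `&` chart_dom c)) (u \o chart_inv c).

Definition smooth_map (R : realType) (m n : nat) (P : manifold R m)
    (Q : manifold R n) (f : P -> Q) : Prop :=
  continuous f /\
  forall d, @atlas R n Q d ->
    smooth_fun (f @^-1` chart_dom d) ((d : Q -> 'rV[R]_n) \o f).

(* f_* v in T_(f p) Q, for v in T_p P. *)
Definition tmap (R : realType) (m n : nat) (P : manifold R m)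
    (Q : manifold R n) (f : P -> Q) (p : P) (v : 'rV[R]_m) : 'rV[R]_n :=
  dir p v ((chart_at (f p) : Q -> 'rV[R]_n) \o f).

(* [dir (f q) (V q) d] is the vector of components of V q in the chart d. *)
Definition smooth_along (R : realType) (m n : nat) (P : manifold R m)
    (Q : manifold R n) (f : P -> Q) (U : set P) (V : P -> 'rV[R]_n) : Prop :=
  forall d, @atlas R n Q d ->
    smooth_fun (U `&` (f @^-1` chart_dom d)) (fun q => dir (f q) (V q) d).

Definition smooth_vf (R : realType) (n : nat) (M : manifold R n)
    (U : set M) (X : M -> 'rV[R]_n) : Prop :=
  @smooth_along R n n M M id U X.

Definition form1 (R : realType) (n : nat) (M : manifold R n)
    (eta : M -> 'cV[R]_n) (p : M) (v : 'rV[R]_n) : R :=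
  (v *m eta p) 0 0.

Definition form2 (R : realType) (n : nat) (M : manifold R n)
    (g : M -> 'M[R]_n) (p : M) (u v : 'rV[R]_n) : R :=
  (u *m g p *m v^T) 0 0.

Definition smooth_tensor11 (R : realType) (n : nat) (M : manifold R n)
    (J : M -> 'M[R]_n) : Prop :=
  forall (U : set M) X, open U -> smooth_vf U X ->
    smooth_vf U (fun p => X p *m J p).

Definition smooth_form1 (R : realType) (n : nat) (M : manifold R n)
    (eta : M -> 'cV[R]_n) : Prop :=
  forall (U : set M) X, open U -> smooth_vf U X ->
    smooth_fun U (fun p => form1 eta p (X p) : R^o).

Definition smooth_form2 (R : realType) (n : nat) (M : manifold R n)
    (g : M -> 'M[R]_n) : Prop :=
  forall (U : set M) X Y, open U -> smooth_vf U X -> smooth_vf U Y ->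
    smooth_fun U (fun p => form2 g p (X p) (Y p) : R^o).

Definition pseudo_riemannian (R : realType) (n : nat) (M : manifold R n)
    (g : M -> 'M[R]_n) : Prop :=
  smooth_form2 g /\ forall p, (g p)^T = g p /\ g p \in unitmx.

(* a plus signs, b minus signs *)
Definition has_signature (R : realType) (n : nat) (a b : nat)
    (G : 'M[R]_n) : Prop :=
  (a + b)%N = n /\
  exists2 B : 'M[R]_n, B \in unitmx &
    B *m G *m B^T = diag_mx (\row_i (if (i < a)%N then 1 else -1)).

(* A linear connection on the bundle f^{-1}(TQ) over P. [D p v V] is the
   derivative at p, in the direction v in T_p P, of the section V of f^{-1}(TQ);
   it is only constrained for V smooth around p, and depends only on the germ
   of V at p. *)
Definition connection_along (R : realType) (m n : nat) (P : manifold R m)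
    (Q : manifold R n) (f : P -> Q)
    (D : P -> 'rV[R]_m -> (P -> 'rV[R]_n) -> 'rV[R]_n) : Prop :=
  [/\ (forall (U : set P) V p, open U -> U p -> smooth_along f U V ->
         linear (fun v => D p v V)),
      (forall (U : set P) V W p v, open U -> U p ->
         smooth_along f U V -> smooth_along f U W ->
         D p v (fun q => V q + W q) = D p v V + D p v W),
      (forall (U : set P) (u : P -> R^o) V p v, open U -> U p ->
         smooth_fun U u -> smooth_along f U V ->
         D p v (fun q => u q *: V q) = dir p v u *: V p + u p *: D p v V),
      (forall (U : set P) V W p v, open U -> U p ->
         smooth_along f U V -> (forall q, U q -> V q = W q) ->
         D p v V = D p v W)
    & (forall (U : set P) X V, open U ->
         smooth_vf U X -> smooth_along f U V ->
         smooth_along f U (fun q => D q (X q) V))].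

Definition connection (R : realType) (n : nat) (M : manifold R n)
    (nabla : M -> 'rV[R]_n -> (M -> 'rV[R]_n) -> 'rV[R]_n) : Prop :=
  @connection_along R n n M M id nabla.

(* nabla_X Y - nabla_Y X = [X, Y], the bracket being given by its action on
   smooth functions. *)
Definition torsion_free (R : realType) (n : nat) (M : manifold R n)
    (nabla : M -> 'rV[R]_n -> (M -> 'rV[R]_n) -> 'rV[R]_n) : Prop :=
  forall (U : set M) X Y (u : M -> R^o) p, open U -> U p ->
    smooth_vf U X -> smooth_vf U Y -> smooth_fun U u ->
    dir p (nabla p (X p) Y - nabla p (Y p) X) u =
      dir p (X p) (fun q => dir q (Y q) u) -
      dir p (Y p) (fun q => dir q (X q) u).

Definition metric_connection (R : realType) (n : nat) (M : manifold R n)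
    (g : M -> 'M[R]_n)
    (nabla : M -> 'rV[R]_n -> (M -> 'rV[R]_n) -> 'rV[R]_n) : Prop :=
  forall (U : set M) Y Z p v, open U -> U p -> smooth_vf U Y -> smooth_vf U Z ->
    dir p v (fun q => form2 g q (Y q) (Z q) : R^o) =
      form2 g p (nabla p v Y) (Z p) + form2 g p (Y p) (nabla p v Z).

Definition levi_civita (R : realType) (n : nat) (M : manifold R n)
    (g : M -> 'M[R]_n)
    (nabla : M -> 'rV[R]_n -> (M -> 'rV[R]_n) -> 'rV[R]_n) : Prop :=
  [/\ connection nabla, torsion_free nabla & metric_connection g nabla].

(* The connection on f^{-1}(TQ) is determined by its values on the sections
   Y \o f, with Y a vector field on Q. *)
Definition pullback_connection (R : realType) (m n : nat) (P : manifold R m)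
    (Q : manifold R n) (f : P -> Q)
    (nabla : Q -> 'rV[R]_n -> (Q -> 'rV[R]_n) -> 'rV[R]_n)
    (D : P -> 'rV[R]_m -> (P -> 'rV[R]_n) -> 'rV[R]_n) : Prop :=
  connection_along f D /\
  forall (W : set Q) Y p v, open W -> W (f p) -> smooth_vf W Y ->
    D p v (Y \o f) = nabla (f p) (tmap f p v) Y.

Definition second_fundamental_form (R : realType) (m n : nat)
    (P : manifold R m) (Q : manifold R n) (f : P -> Q)
    (nabla : P -> 'rV[R]_m -> (P -> 'rV[R]_m) -> 'rV[R]_m)
    (D : P -> 'rV[R]_m -> (P -> 'rV[R]_n) -> 'rV[R]_n)
    (X Y : P -> 'rV[R]_m) (p : P) : 'rV[R]_n :=
  D p (X p) (fun q => tmap f q (Y q)) - tmap f p (nabla p (X p) Y).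

Definition orthonormal_frame (R : realType) (m : nat) (P : manifold R m)
    (g : P -> 'M[R]_m) (U : set P) (e : 'I_m -> P -> 'rV[R]_m) : Prop :=
  (forall i, smooth_vf U (e i)) /\
  forall q, U q ->
    (forall i, form2 g q (e i q) (e i q) = 1 \/
               form2 g q (e i q) (e i q) = -1) /\
    (forall i j, i != j -> form2 g q (e i q) (e j q) = 0).

(* tau is the tension field tau(f). The sum below does not depend on the chosen
   frame, so it is enough to ask for one frame around each point. *)
Definition tension_field (R : realType) (m n : nat)
    (P : manifold R m) (Q : manifold R n) (f : P -> Q) (g : P -> 'M[R]_m)
    (nabla : P -> 'rV[R]_m -> (P -> 'rV[R]_m) -> 'rV[R]_m)
    (D : P -> 'rV[R]_m -> (P -> 'rV[R]_n) -> 'rV[R]_n)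
    (tau : P -> 'rV[R]_n) : Prop :=
  forall p, exists (U : set P) (e : 'I_m -> P -> 'rV[R]_m),
    [/\ open U, U p, orthonormal_frame g U e
      & forall q, U q ->
          tau q = \sum_(i < m) form2 g q (e i q) (e i q) *:
                    second_fundamental_form f nabla D (e i) (e i) q].

Definition almost_para_hermitian (R : realType) (m : nat)
    (N : manifold R (2 * m)) (J h : N -> 'M[R]_(2 * m)) : Prop :=
  [/\ smooth_tensor11 J, pseudo_riemannian h,
      (forall p, J p *m J p = 1%:M),
      (forall p, \rank (eigenspace (J p) 1) = \rank (eigenspace (J p) (-1)))
    & (forall p u v, form2 h p (u *m J p) v = - form2 h p u (v *m J p))].

(* eta p *m xi p is the matrix of eta (x) xi; kermx (eta p) spans ker eta. *)
Definition almost_paracontact_metric (R : realType) (n : nat)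
    (M : manifold R (2 * n + 1)) (phi : M -> 'M[R]_(2 * n + 1))
    (xi : M -> 'rV[R]_(2 * n + 1)) (eta : M -> 'cV[R]_(2 * n + 1))
    (g : M -> 'M[R]_(2 * n + 1)) : Prop :=
  [/\ [/\ smooth_tensor11 phi, smooth_vf setT xi, smooth_form1 eta
        & pseudo_riemannian g],
      (forall p, phi p *m phi p = 1%:M - eta p *m xi p) /\
      (forall p, form1 eta p (xi p) = 1),
      (forall p, \rank (eigenspace (phi p) 1 :&: kermx (eta p))%MS = n /\
                 \rank (eigenspace (phi p) (-1) :&: kermx (eta p))%MS = n),
      (forall p, has_signature n.+1 n (g p))
    & (forall p u v, form2 g p (u *m phi p) (v *m phi p) =
         - form2 g p u v + form1 eta p u * form1 eta p v)].

(* (nabla_X phi) Y = nabla_X (phi Y) - phi (nabla_X Y) *)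
Definition para_sasakian (R : realType) (n : nat)
    (M : manifold R (2 * n + 1)) (phi : M -> 'M[R]_(2 * n + 1))
    (xi : M -> 'rV[R]_(2 * n + 1)) (eta : M -> 'cV[R]_(2 * n + 1))
    (g : M -> 'M[R]_(2 * n + 1))
    (nabla : M -> 'rV[R]_(2 * n + 1) -> (M -> 'rV[R]_(2 * n + 1)) ->
             'rV[R]_(2 * n + 1)) : Prop :=
  [/\ almost_paracontact_metric phi xi eta g, levi_civita g nabla
    & forall (U : set M) X Y p, open U -> U p ->
        smooth_vf U X -> smooth_vf U Y ->
        nabla p (X p) (fun q => Y q *m phi q) - nabla p (X p) Y *m phi p =
          - (form2 g p (X p) (Y p) *: xi p) + form1 eta p (Y p) *: X p].

Definition paraholomorphic (R : realType) (m n : nat) (N : manifold R m)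
    (M : manifold R n) (J : N -> 'M[R]_m) (phi : M -> 'M[R]_n)
    (f : N -> M) : Prop :=
  forall p v, tmap f p (v *m J p) = tmap f p v *m phi (f p).

(* The distribution D = ker eta. *)
Definition ker_distribution (R : realType) (n : nat) (M : manifold R n)
    (eta : M -> 'cV[R]_n) (p : M) : set 'rV[R]_n :=
  [set v | form1 eta p v = 0].

(* Main.v *)
Require Import Defs.
From HB Require Import structures.
From mathcomp Require Import all_boot all_order all_algebra.
From mathcomp Require Import all_classical all_reals all_analysis.

Set Implicit Arguments.
Unset Strict Implicit.
Unset Printing Implicit Defensive.

Import Order.TTheory GRing.Theory Num.Theory.
Import numFieldNormedType.Exports.

Local Open Scope classical_set_scope.
Local Open Scope ring_scope.

(** Write [<.,.>] for the metric [g1]; every single term [alpha_f(X, X)] of the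
    trace, not only their sum, turns out to lie in [ker eta1].

    Since [eta1] kills the image of [phi1] and [J] is invertible,
    paraholomorphy makes every [f_* v = phi1 (f_* (J v))] horizontal.  So
    [f_* nabla_X X] is horizontal, and it remains to treat [D_X V] for the
    section [V = f_* X].  Differentiating [0 = eta1(V) = <V, xi1>] along [X]
    gives [eta1(D_X V) = - <V, nabla_V xi1>], because the pullback connection
    inherits metric compatibility ([pullback_connection_metric]).  Putting
    [Y = xi1] in the para-Sasakian identity gives [phi1 (nabla_V xi1) = - V] for
    a horizontal [V], and [<phi1 Z, Z> = 0] by skewness of [phi1], so the right
    hand side vanishes ([para_sasakian_nabla_xi]).

    The compatibility of the pullback connection is immediate for sections of
    the form [Y \o f] only; a general section along [f] has to be expanded in
    the coordinate fields of a chart of the target, with smooth coefficients.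
    The axioms of a connection apply to smooth data only, so this rests on the
    calculus of smooth functions: closure of iterated differentiability under
    sums, products and composition, independence of the chart, and the chain
    rule for [dir] and [tmap]. *)

(** * Differentiability *)

(** The expansion defining the differential of [f] at [x] only sees the germ of
    [f], so ['d f x] also serves as the differential of [g]. *)
Lemma near_eq_differentiable (R : realType) (V W : normedModType R)
    (f g : V -> W) (x : V) :
  (\near x, f x = g x) -> differentiable f x -> differentiable g x.
Proof.
move=> fg df; have [cdf fE] := (diff_locallyP x f).1 df.
have gE : g \o shift x = cst (g x) + 'd f x +o_ 0 id.
  apply/eqaddoP => e e0; have /eqaddoP/(_ _ e0) := fE.
  have fg0 : \forall h \near 0, f (h + x) = g (h + x).
    have shx : h + x @[h --> (0 : V)] --> x.
      by rewrite -[X in _ --> X]add0r; apply: cvgD; [exact: cvg_id|exact: cvg_cst].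
    exact: shx fg.
  move=> fo; near=> h.
  have -> : (g \o shift x - (cst (g x) + 'd f x)) h =
            (f \o shift x - (cst (f x) + 'd f x)) h.
    rewrite -[LHS]/(g (h + x) - (g x + 'd f x h)).
    rewrite -[RHS]/(f (h + x) - (f x + 'd f x h)).
    by rewrite (nbhs_singleton fg) (near fg0).
  by near: h.
apply/diff_locallyP; have -> := diff_unique cdf gE; by split.
Unshelve. all: by end_near. Qed.

Section scale.
Variables (R : realType) (V : normedModType R).

Fact scaler_is_bilinear :
  bilinear_for
    (GRing.Scale.Law.clone _ _ *:%R _) (GRing.Scale.Law.clone _ _ *:%R _)
    (@GRing.scale R V : R^o -> V -> V).
Proof.
split=> [u'|u] a x y /=.
- by rewrite scalerDl scalerA.
- by rewrite scalerDr !scalerA mulrC.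
Qed.

HB.instance Definition _ := bilinear_isBilinear.Build R R^o V V _ _
  (@GRing.scale R V : R^o -> V -> V) scaler_is_bilinear.

(** The Leibniz rule, obtained from the differential of the bilinear map
    [*:%R] composed with [y |-> (u y, F y)]. *)
Lemma is_diff_scale (U : normedModType R) (u : U -> R^o) (F : U -> V) x :
  differentiable u x -> differentiable F x ->
  is_diff x (fun y => u y *: F y) (fun v => u x *: 'd F x v + 'd u x v *: F x).
Proof.
move=> du dF.
pose b : {bilinear R^o -> V -> V} := (@GRing.scale R V : R^o -> V -> V).
have cb : continuous (fun p : R^o * V => b p.1 p.2).
  by move=> p; apply: (@scale_continuous R V).
have -> : (fun y => u y *: F y) = (fun p => b p.1 p.2) \o (fun y => (u y, F y)).
  by [].
have dp := differentiable_pair du dF.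
have db := differentiable_bilin (u x, F x) cb.
apply: DiffDef; first exact: differentiable_comp.
by rewrite diff_comp // diff_bilin // diff_pair.
Qed.

Lemma differentiable_scale (U : normedModType R) (u : U -> R^o) (F : U -> V)
    x :
  differentiable u x -> differentiable F x ->
  differentiable (fun y => u y *: F y) x.
Proof. by move=> du dF; have [] := is_diff_scale du dF. Qed.

End scale.

(** * Germs of smooth functions on a numerical space *)

Lemma derive_comp (R : realType) (U V W : normedModType R) (F : U -> V)
    (G : V -> W) (x v : U) :
  differentiable F x -> differentiable G (F x) ->
  'D_v (G \o F) x = 'D_('D_v F x) G (F x).
Proof.
move=> dF dG.
rewrite (deriveE v (differentiable_comp dF dG)) diff_comp //.
by rewrite (deriveE v dF) (deriveE _ dG).
Qed.

Lemma derive_coord (R : realType) (n : nat) (V : normedModType R)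
    (G : 'rV[R]_n -> V) (x w : 'rV[R]_n) :
  differentiable G x ->
  'D_w G x = \sum_(j < n) w 0 j *: 'D_(delta_mx 0 j) G x.
Proof.
move=> dG; rewrite deriveE // [in LHS](row_sum_delta w) linear_sum.
by apply: eq_bigr => j _; rewrite linearZ deriveE.
Qed.

(** Being of class C^k around [x], by recursion on [k] so that closure
    properties follow by induction.  The neighbourhood of [x] may shrink when
    [k] grows; this is harmless, since [smooth_rV] over an open set only asks
    for differentiability at each point separately (see [smooth_germP]). *)
Fixpoint Ck_germ (R : realType) (n : nat) (V : normedModType R) (k : nat)
    (x : 'rV[R]_n) (F : 'rV[R]_n -> V) : Prop :=
  (\forall y \near x, differentiable F y) /\
  (if k is k'.+1 then forall v, Ck_germ k' x ('D_v F) else True).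

Definition smooth_germ (R : realType) (n : nat) (V : normedModType R)
    (x : 'rV[R]_n) (F : 'rV[R]_n -> V) : Prop :=
  forall k, Ck_germ k x F.

Section germ.
Variables (R : realType) (n : nat).
Implicit Types (x : 'rV[R]_n) (k : nat).

Lemma Ck_germ_diff (V : normedModType R) k x (F : 'rV[R]_n -> V) :
  Ck_germ k x F -> \forall y \near x, differentiable F y.
Proof. by case: k => [|k] []. Qed.

Lemma Ck_germW (V : normedModType R) k x (F : 'rV[R]_n -> V) :
  Ck_germ k.+1 x F -> Ck_germ k x F.
Proof.
elim: k F => [|k IHk] F [dF DF]; split=> // v.
exact/IHk/DF.
Qed.

Lemma near_eq_Ck_germ (V : normedModType R) k x (F G : 'rV[R]_n -> V) :
  (\forall y \near x, F y = G y) -> Ck_germ k x F -> Ck_germ k x G.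
Proof.
elim: k F G => [|k IHk] F G FG [dF DF].
- split=> //; have FG' := near_join FG; near=> y.
  by apply: (@near_eq_differentiable _ _ _ F); near: y.
- have FG' := near_join FG; split.
    near=> y.
    by apply: (@near_eq_differentiable _ _ _ F); near: y.
  move=> v; apply: IHk (DF v); near=> y.
  have FGy : \forall z \near y, F z = G z by near: y.
  exact: near_eq_derive.
Unshelve. all: by end_near. Qed.

Lemma Ck_germ_cst (V : normedModType R) k x (a : V) : Ck_germ k x (cst a).
Proof.
elim: k a => [|k IHk] a; split=> //; try by near=> y; apply: differentiable_cst.
move=> v; have -> : 'D_v (cst a : 'rV[R]_n -> V) = cst 0.
  by apply/funext => y; rewrite derive_cst.
exact: IHk.
Unshelve. all: by end_near. Qed.

Lemma Ck_germD (V : normedModType R) k x (F G : 'rV[R]_n -> V) :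
  Ck_germ k x F -> Ck_germ k x G -> Ck_germ k x (fun y => F y + G y).
Proof.
elim: k F G => [|k IHk] F G [dF DF] [dG DG]; split=> //; try by
  near=> y; apply: differentiableD; near: y.
move=> v; apply: (near_eq_Ck_germ _ (IHk _ _ (DF v) (DG v))).
near=> y; rewrite -[RHS]/('D_v (F + G) y) deriveD //.
  by apply: diff_derivable; near: y.
by apply: diff_derivable; near: y.
Unshelve. all: by end_near. Qed.

Lemma Ck_germ_sum (V : normedModType R) k x m (F : 'I_m -> 'rV[R]_n -> V) :
  (forall i, Ck_germ k x (F i)) -> Ck_germ k x (fun y => \sum_(i < m) F i y).
Proof.
move=> sF.
have -> : (fun y => \sum_(i < m) F i y) = \sum_(i < m) F i.
  by apply/funext => y; rewrite fct_sumE.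
elim/big_ind: _ => [|G H|i _]; [exact: Ck_germ_cst|exact: Ck_germD|exact: sF].
Qed.

(** The derivative of a product involves the factors themselves along with
    their derivatives, whence the appeal to [Ck_germW] in the induction. *)
Lemma Ck_germ_scale (V : normedModType R) k x (u : 'rV[R]_n -> R^o)
    (F : 'rV[R]_n -> V) :
  Ck_germ k x u -> Ck_germ k x F -> Ck_germ k x (fun y => u y *: F y).
Proof.
elim: k u F => [|k IHk] u F su sF; split=> //; try by
  case: su sF => du _ [dF _]; near=> y; apply: differentiable_scale; near: y.
move=> v; have su' := Ck_germW su; have sF' := Ck_germW sF.
case: su sF => du Du [dF DF].
apply: (near_eq_Ck_germ _
  (Ck_germD (IHk _ _ su' (DF v)) (IHk _ _ (Du v) sF'))).
near=> y.
have duy : differentiable u y by near: y.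
have dFy : differentiable F y by near: y.
have [? E] := is_diff_scale duy dFy.
by rewrite !deriveE // E.
Unshelve. all: by end_near. Qed.

Lemma Ck_germ_coord k x m (F : 'rV[R]_n -> 'rV[R]_m) j :
  Ck_germ k x F -> Ck_germ k x (fun y => F y 0 j : R^o).
Proof.
elim: k F => [|k IHk] F [dF DF]; split=> //.
- near=> y; apply: (@differentiable_comp _ _ _ _ F (fun M => M 0 j)).
    by near: y.
  exact: differentiable_coord.
- near=> y; apply: (@differentiable_comp _ _ _ _ F (fun M => M 0 j)).
    by near: y.
  exact: differentiable_coord.
move=> v; apply: (near_eq_Ck_germ _ (IHk _ (DF v))).
near=> y; rewrite derive_mx ?mxE //; apply: diff_derivable.
by near: y.
Unshelve. all: by end_near. Qed.

End germ.

(** By the chain rule a derivative of [G \o F] is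
    [\sum_j (D_v F)_j *: (D_j G \o F)], to which the induction hypothesis applies
    termwise. *)
Lemma Ck_germ_comp (R : realType) (n m k : nat) (V : normedModType R)
    (x : 'rV[R]_n) (F : 'rV[R]_n -> 'rV[R]_m)
    (G : 'rV[R]_m -> V) :
  Ck_germ k x F -> Ck_germ k (F x) G -> Ck_germ k x (G \o F).
Proof.
elim: k F G => [|k IHk] F G sF sG.
all: have dF := Ck_germ_diff sF; have dG := Ck_germ_diff sG.
all: have cF : F y @[y --> x] --> F x
  by apply: differentiable_continuous; exact: nbhs_singleton dF.
all: have dGF : \forall y \near x, differentiable G (F y) by exact: cF dG.
all: split; first by near=> y; apply: differentiable_comp; near: y.
- by [].
have sF' := Ck_germW sF; case: sF sG => _ DF [_ DG] v.
apply: (@near_eq_Ck_germ _ _ _ _ _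
  (fun y => \sum_(j < m) 'D_v F y 0 j *: ('D_(delta_mx 0 j) G \o F) y)).
  near=> y.
  have dFy : differentiable F y by near: y.
  have dGy : differentiable G (F y) by near: y.
  by rewrite (derive_comp _ dFy dGy) (derive_coord _ dGy).
apply: Ck_germ_sum => j; apply: Ck_germ_scale.
  exact: (Ck_germ_coord j (DF v)).
exact: IHk sF' (DG _).
Unshelve. all: by end_near. Qed.

Lemma smooth_germP (R : realType) (n : nat) (V : normedModType R) (A : set 'rV[R]_n)
    (F : 'rV[R]_n -> V) : open A ->
  smooth_rV A F <-> forall x, A x -> smooth_germ x F.
Proof.
move=> oA; split=> [sF x Ax k|sF vs x Ax].
  elim: k F sF => [|k IHk] F sF; split=> //; try by
    apply: filterS (open_nbhs_nbhs (conj oA Ax)) => y Ay; exact: (sF [::]).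
  move=> v; apply: IHk => vs y Ay; rewrite -foldr_rcons; exact: sF.
suff : smooth_germ x (foldr (fun v G => 'D_v G) F vs).
  by move=> /(_ 0%N) [/nbhs_singleton].
elim: vs => [|v vs IHvs] /=; first exact: sF.
by move=> k; have [_ /(_ v)] := IHvs k.+1.
Qed.

(** * Functions on a manifold, read in charts *)

Section charts.
Variables (R : realType) (n : nat).

Lemma chart_inv_continuous_at (T : topologicalType) (c : chart R n T) (p : T) :
  chart_dom c p -> {for c p, continuous (chart_inv c)}.
Proof.
move=> cp; have := @chart_inv_continuous _ _ _ c.
rewrite (continuous_open_subspace _ (@chart_im_open _ _ _ c)); apply.
by rewrite inE; exists p.
Qed.

Lemma chartK (T : topologicalType) (c : chart R n T) (p : T) :
  chart_dom c p -> chart_inv c (c p) = p.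
Proof. by move=> cp; apply: chart_funK; rewrite inE. Qed.

Lemma near_chart_dom (T : topologicalType) (c : chart R n T) (p : T) :
  chart_dom c p -> \forall q \near p, chart_dom c q.
Proof. by move=> cp; apply: open_nbhs_nbhs; split=> //; exact: chart_dom_open. Qed.

Lemma near_chart_inv (T : topologicalType) (c : chart R n T) (p : T)
    (P : T -> Prop) :
  chart_dom c p -> (\forall q \near p, P q) ->
  \forall x \near c p, P (chart_inv c x).
Proof.
move=> cp nP; apply: (chart_inv_continuous_at cp).
by rewrite chartK.
Qed.

Lemma near_chart_invK (T : topologicalType) (c : chart R n T) (p : T) :
  chart_dom c p -> \forall x \near c p, c (chart_inv c x) = x.
Proof.
move=> cp.
have : nbhs (c p) (c @` chart_dom c).
  by apply: open_nbhs_nbhs; split; [exact: chart_im_open | exists p].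
by apply: filterS => _ [q cq <-]; rewrite chartK.
Qed.

(** Smoothness over an open [U] is tested on these images; their openness is
    what allows to localize at a point. *)
Lemma chart_image_open (T : topologicalType) (c : chart R n T) (U : set T) :
  open U -> open (c @` (U `&` chart_dom c)).
Proof.
move=> oU; rewrite openE => _ [p [Up cp] <-].
have nU : \forall x \near c p, U (chart_inv c x).
  by apply: near_chart_inv => //; apply: open_nbhs_nbhs.
have nc := near_chart_inv cp (near_chart_dom cp).
have nK := near_chart_invK cp.
near=> x; exists (chart_inv c x); last by near: x.
by split; near: x.
Unshelve. all: by end_near. Qed.

Variable M : manifold R n.
Implicit Types (c d : chart R n M) (p q : M) (U : set M).

(** The germ at [p] is read in the distinguished chart of [p]; by
    [smooth_at_chart] any chart of the atlas around [p] would do. *)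
Definition smooth_at (V : normedModType R) p (u : M -> V) : Prop :=
  smooth_germ (chart_at p p) (u \o chart_inv (chart_at p)).

Lemma smooth_transition c d p :
  @atlas R n M c -> @atlas R n M d -> chart_dom c p -> chart_dom d p ->
  smooth_germ (c p) (d \o chart_inv c).
Proof.
move=> ac ad cp dp.
have oA : open (c @` (chart_dom c `&` chart_dom d)).
  by rewrite setIC; apply/chart_image_open/chart_dom_open.
by apply: ((smooth_germP _ oA).1 (atlas_smooth ac ad)); exists p.
Qed.

Lemma near_transition c d p (V : Type) (u : M -> V) :
  chart_dom c p -> chart_dom d p ->
  \forall x \near d p,
    ((u \o chart_inv c) \o (c \o chart_inv d)) x = (u \o chart_inv d) x.
Proof.
move=> cp dp; have nc := near_chart_inv dp (near_chart_dom cp).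
near=> x; rewrite /= chartK //; near: x; exact: nc.
Unshelve. all: by end_near. Qed.

Lemma smooth_germ_transition (V : normedModType R) c d p (u : M -> V) :
  @atlas R n M c -> @atlas R n M d -> chart_dom c p -> chart_dom d p ->
  smooth_germ (c p) (u \o chart_inv c) -> smooth_germ (d p) (u \o chart_inv d).
Proof.
move=> ac ad cp dp su k.
apply: (near_eq_Ck_germ (near_transition u cp dp)).
apply: Ck_germ_comp; first exact: smooth_transition.
by rewrite /= chartK //; exact: su.
Qed.

Lemma smooth_at_chart (V : normedModType R) c p (u : M -> V) :
  @atlas R n M c -> chart_dom c p ->
  smooth_at p u <-> smooth_germ (c p) (u \o chart_inv c).
Proof.
move=> ac cp; split; apply: smooth_germ_transition => //;
  by [exact: chart_at_atlas | exact: chart_at_dom].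
Qed.

Lemma smooth_funP (V : normedModType R) U (u : M -> V) : open U ->
  smooth_fun U u <-> forall p, U p -> smooth_at p u.
Proof.
move=> oU; split=> [su p Up|su c ac].
  have oA := @chart_image_open _ (chart_at p) U oU.
  apply: ((smooth_germP _ oA).1 (su _ (chart_at_atlas p))).
  by exists p => //; split=> //; exact: chart_at_dom.
apply/(smooth_germP _ (@chart_image_open _ c U oU)) => _ [p [Up cp] <-].
exact/(smooth_at_chart u ac cp)/su.
Qed.

Lemma smooth_at_differentiable (V : normedModType R) c p (u : M -> V) :
  @atlas R n M c -> chart_dom c p -> smooth_at p u ->
  differentiable (u \o chart_inv c) (c p).
Proof.
move=> ac cp /(smooth_at_chart u ac cp) /(_ 0%N) /Ck_germ_diff.
exact: nbhs_singleton.
Qed.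

Lemma smooth_at_chart_fun c p :
  @atlas R n M c -> chart_dom c p -> smooth_at p c.
Proof.
move=> ac cp; apply: smooth_transition => //.
  exact: chart_at_atlas.
exact: chart_at_dom.
Qed.

Lemma near_eq_smooth_at (V : normedModType R) p (u w : M -> V) :
  (\forall q \near p, u q = w q) -> smooth_at p u -> smooth_at p w.
Proof.
move=> uw su k; apply: near_eq_Ck_germ (su k).
exact: (near_chart_inv (chart_at_dom p) uw).
Qed.

Lemma smooth_at_cst (V : normedModType R) p (a : V) : smooth_at p (fun=> a).
Proof. by move=> k; apply: Ck_germ_cst. Qed.

Lemma smooth_at_sum (V : normedModType R) p m (u : 'I_m -> M -> V) :
  (forall i, smooth_at p (u i)) -> smooth_at p (fun q => \sum_(i < m) u i q).
Proof.
by move=> su k; apply: (@Ck_germ_sum _ _ _ _ _ _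
  (fun i => u i \o chart_inv (chart_at p))) => i; apply: su.
Qed.

Lemma smooth_at_scale (V : normedModType R) p (a : M -> R^o) (u : M -> V) :
  smooth_at p a -> smooth_at p u -> smooth_at p (fun q => a q *: u q).
Proof. by move=> sa su k; apply: Ck_germ_scale (sa k) (su k). Qed.

Lemma smooth_at_coord m p (u : M -> 'rV[R]_m) j :
  smooth_at p u -> smooth_at p (fun q => u q 0 j : R^o).
Proof. by move=> su k; apply: Ck_germ_coord j (su k). Qed.

(** Partial derivatives in a chart are defined by total functions on the whole
    manifold, but are meaningful on the domain of the chart, where they stay
    smooth. *)
Lemma smooth_at_pderive (V : normedModType R) c p (u : M -> V) w :
  @atlas R n M c -> chart_dom c p -> smooth_at p u ->
  smooth_at p (fun q => 'D_w (u \o chart_inv c) (c q)).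
Proof.
move=> ac cp /(smooth_at_chart u ac cp) su; apply/(smooth_at_chart _ ac cp) => k.
apply: (@near_eq_Ck_germ _ _ _ _ _ ('D_w (u \o chart_inv c))).
  have nK := near_chart_invK cp.
  by near=> x; rewrite /= (near nK x).
by have [_ /(_ w)] := su k.+1.
Unshelve. all: by end_near. Qed.

(** * Derivatives along tangent vectors *)

(** The chain rule for a change of chart: [w], seen in the chart [d], has
    components ['D_w (c \o chart_inv d) (d p)] in the chart [c]. *)
Lemma derive_transition (V : normedModType R) c d p (u : M -> V) w :
  @atlas R n M c -> @atlas R n M d -> chart_dom c p -> chart_dom d p ->
  smooth_at p u ->
  'D_w (u \o chart_inv d) (d p) =
  'D_('D_w (c \o chart_inv d) (d p)) (u \o chart_inv c) (c p).
Proof.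
move=> ac ad cp dp su.
rewrite -(near_eq_derive w (near_transition u cp dp)) derive_comp /= ?chartK //.
- exact: smooth_at_differentiable (smooth_at_chart_fun ac cp).
- exact: smooth_at_differentiable su.
Qed.

Lemma dir_chart (V : normedModType R) c p (u : M -> V) v :
  @atlas R n M c -> chart_dom c p -> smooth_at p u ->
  dir p v u = 'D_(dir p v c) (u \o chart_inv c) (c p).
Proof.
move=> ac cp su; apply: derive_transition => //.
  exact: chart_at_atlas.
exact: chart_at_dom.
Qed.

(** Tangent vectors at [p] are encoded by their components in [chart_at p]. *)
Lemma dir_chart_at p v : dir p v (chart_at p) = v.
Proof.
rewrite /dir (@near_eq_derive _ _ _ _ id) ?derive_id //.
exact: near_chart_invK (chart_at_dom p).
Qed.

Lemma near_eq_dir (V : normedModType R) p v (u w : M -> V) :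
  (\forall q \near p, u q = w q) -> dir p v u = dir p v w.
Proof.
by move=> uw; apply: near_eq_derive; apply: near_chart_inv (chart_at_dom p) uw.
Qed.

Lemma dir_linear (V : normedModType R) p (u : M -> V) :
  smooth_at p u -> linear (fun v => dir p v u).
Proof.
move=> su a v w; rewrite /dir !deriveE ?linearP //;
  exact: smooth_at_differentiable (chart_at_atlas p) (chart_at_dom p) su.
Qed.

Lemma smooth_at_derivable (V : normedModType R) p (u : M -> V) v :
  smooth_at p u -> derivable (u \o chart_inv (chart_at p)) (chart_at p p) v.
Proof.
move=> su; apply: diff_derivable.
exact: smooth_at_differentiable (chart_at_atlas p) (chart_at_dom p) su.
Qed.

Lemma dir_scale (V : normedModType R) p v (a : M -> R^o) (u : M -> V) :
  smooth_at p a -> smooth_at p u ->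
  dir p v (fun q => a q *: u q) = dir p v a *: u p + a p *: dir p v u.
Proof.
move=> sa su.
have da := smooth_at_differentiable (chart_at_atlas p) (chart_at_dom p) sa.
have du := smooth_at_differentiable (chart_at_atlas p) (chart_at_dom p) su.
have [dau E] := is_diff_scale da du.
have pK := chartK (chart_at_dom p).
rewrite addrC /dir (deriveE v da) (deriveE v du).
have -> : a p = (a \o chart_inv (chart_at p)) (chart_at p p) by rewrite /= pK.
have -> : u p = (u \o chart_inv (chart_at p)) (chart_at p p) by rewrite /= pK.
by move/(congr1 (@^~ v)): E => <-; exact: deriveE v dau.
Qed.

Lemma dir_sum (V : normedModType R) p v m (u : 'I_m -> M -> V) :
  (forall i, smooth_at p (u i)) ->
  dir p v (fun q => \sum_(i < m) u i q) = \sum_(i < m) dir p v (u i).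
Proof.
move=> su; rewrite /dir.
have -> : (fun q => \sum_(i < m) u i q) \o chart_inv (chart_at p) =
  \sum_(i < m) (u i \o chart_inv (chart_at p)).
  by apply/funext => x; rewrite fct_sumE.
by rewrite derive_sum // => i; exact: smooth_at_derivable.
Qed.

(** * Coordinate vector fields *)

(** The vector field with constant components [w] in the chart [c]: its value
    at [q] has to be written in the basis of [chart_at q]. *)
Definition coord_field c (w : 'rV[R]_n) q : 'rV[R]_n :=
  'D_w (chart_at q \o chart_inv c) (c q).

Lemma dir_coord_field (V : normedModType R) c q (u : M -> V) w :
  @atlas R n M c -> chart_dom c q -> smooth_at q u ->
  dir q (coord_field c w q) u = 'D_w (u \o chart_inv c) (c q).
Proof.
move=> ac cq su; rewrite (derive_transition (c := chart_at q)) //.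
  exact: chart_at_atlas.
exact: chart_at_dom.
Qed.

Lemma coord_field_dir c q v :
  @atlas R n M c -> chart_dom c q -> coord_field c (dir q v c) q = v.
Proof.
move=> ac cq; rewrite /coord_field -dir_chart ?dir_chart_at //.
apply: smooth_at_chart_fun; [exact: chart_at_atlas|exact: chart_at_dom].
Qed.

(** The coefficients are components in a fixed chart, so they depend smoothly on
    [q] when [v] runs through a smooth field or section. *)
Lemma coord_field_expand c q v :
  @atlas R n M c -> chart_dom c q ->
  v = \sum_(j < n) dir q v c 0 j *: coord_field c (delta_mx 0 j) q.
Proof.
move=> ac cq; rewrite -[LHS](coord_field_dir v ac cq); apply: derive_coord.
apply: smooth_at_differentiable => //.
apply: smooth_at_chart_fun; [exact: chart_at_atlas|exact: chart_at_dom].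
Qed.

End charts.

(** * Composition with a smooth map *)

Section maps.
Variables (R : realType) (m n : nat) (P : manifold R m) (Q : manifold R n).
Variable f : P -> Q.
Hypothesis sf : smooth_map f.
Implicit Types (p q : P) (U : set P) (V W : P -> 'rV[R]_n).

Lemma near_preimage (A : Q -> Prop) p :
  (\forall y \near f p, A y) -> \forall q \near p, A (f q).
Proof. by move=> nA; apply: (sf.1 p). Qed.

Lemma open_preimage (A : set Q) : open A -> open (f @^-1` A).
Proof. by apply: open_comp => q _; exact: sf.1. Qed.

Lemma smooth_at_chart_comp (d : chart R n Q) p :
  @atlas R n Q d -> chart_dom d (f p) -> smooth_at p (d \o f).
Proof.
move=> ad dp.
have oU : open (f @^-1` chart_dom d) by apply/open_preimage/chart_dom_open.
exact: ((smooth_funP _ oU).1 (sf.2 d ad)).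
Qed.

(** Near [p], the coordinate expression of [u \o f] is the composite of those
    of [u] and [f]. *)
Lemma near_chart_comp (d : chart R n Q) p (X : Type) (u : Q -> X) :
  chart_dom d (f p) ->
  \forall x \near chart_at p p,
    ((u \o chart_inv d) \o ((d \o f) \o chart_inv (chart_at p))) x =
    ((u \o f) \o chart_inv (chart_at p)) x.
Proof.
move=> dp.
have nd := near_chart_inv (chart_at_dom p) (near_preimage (near_chart_dom dp)).
by near=> x; rewrite /= chartK //; near: x; exact: nd.
Unshelve. all: by end_near. Qed.

Lemma smooth_at_comp (X : normedModType R) p (u : Q -> X) :
  smooth_at (f p) u -> smooth_at p (u \o f).
Proof.
move=> su k; have dp := chart_at_dom (f p).
apply: (near_eq_Ck_germ (near_chart_comp u dp)).
apply: Ck_germ_comp.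
  exact: (smooth_at_chart_comp (chart_at_atlas (f p)) dp).
by rewrite /= [chart_inv _ _]chartK //; exact: chart_at_dom.
Qed.

(** The chain rule, through the chart [chart_at (f p)] in whose basis [tmap]
    expresses [f_* v]. *)
Lemma dir_tmap (X : normedModType R) p v (u : Q -> X) :
  smooth_at (f p) u -> dir (f p) (tmap f p v) u = dir p v (u \o f).
Proof.
move=> su; have dp := chart_at_dom (f p); have ad := chart_at_atlas (f p).
have cp := chart_at_dom p; have ac := chart_at_atlas p.
rewrite [RHS]/dir -(near_eq_derive v (near_chart_comp u dp)).
have pK : ((chart_at (f p) \o f) \o chart_inv (chart_at p)) (chart_at p p) =
  chart_at (f p) (f p) by rewrite /= [chart_inv _ _]chartK.
rewrite derive_comp ?pK //.
- exact: smooth_at_differentiable ac cp (smooth_at_chart_comp ad dp).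
- exact: smooth_at_differentiable ad dp su.
Qed.

End maps.

(** * Smooth sections along a map *)
Section sections_along.
Variables (R : realType) (m n : nat) (P : manifold R m) (Q : manifold R n).
Variable f : P -> Q.
Implicit Types (p q : P) (U : set P) (V W : P -> 'rV[R]_n).

Lemma smooth_alongP U V : continuous f -> open U ->
  smooth_along f U V <->
  forall d p, @atlas R n Q d -> U p -> chart_dom d (f p) ->
    smooth_at p (fun q => dir (f q) (V q) d).
Proof.
move=> cf oU.
have oUd (d : chart R n Q) : open (U `&` f @^-1` chart_dom d).
  apply: openI => //; apply: open_comp; last exact: chart_dom_open.
  by move=> q _; exact: cf.
split=> [sV d p ad Up dp|sV d ad].
  exact: ((smooth_funP _ (oUd d)).1 (sV d ad)).

by apply/(smooth_funP _ (oUd d)) => p [Up dp]; exact: sV.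
Qed.

Lemma smooth_along_subset U U' V : continuous f -> open U -> open U' ->
  U' `<=` U -> smooth_along f U V -> smooth_along f U' V.
Proof.
move=> cf oU oU' U'U /(smooth_alongP V cf oU) sV.
by apply/(smooth_alongP V cf oU') => d p ad /U'U; exact: sV.
Qed.

(** Sums and multiples of sections are formed in the moving bases given by the
    [chart_at]; passing to components in a fixed chart commutes with them. *)
Lemma near_chart_linear p (d : chart R n Q) :
  continuous f -> @atlas R n Q d -> chart_dom d (f p) ->
  \forall q \near p, linear (fun v => dir (f q) v d).
Proof.
move=> cf ad dp; near=> q; apply: dir_linear.
apply: smooth_at_chart_fun => //; near: q.
exact: (cf p _ (near_chart_dom dp)).
Unshelve. all: by end_near. Qed.

Lemma smooth_along_sum U k (V : 'I_k -> P -> 'rV[R]_n) :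
  continuous f -> open U -> (forall i, smooth_along f U (V i)) ->
  smooth_along f U (fun q => \sum_(i < k) V i q).
Proof.
move=> cf oU sV; apply/(smooth_alongP _ cf oU) => d p ad Up dp.
have ld := near_chart_linear cf ad dp.
apply: (@near_eq_smooth_at _ _ _ _ _
  (fun q => \sum_(i < k) dir (f q) (V i q) d)).
  near=> q; have lq : linear (fun v => dir (f q) v d) by near: q.
  pose lM := GRing.isLinear.Build _ _ _ _ _ lq.
  pose L : {linear _ -> _} := HB.pack (fun v => dir (f q) v d) lM.
  by rewrite -[RHS]/(L _) linear_sum.
apply: smooth_at_sum => i.
exact: ((smooth_alongP _ cf oU).1 (sV i)).
Unshelve. all: by end_near. Qed.

Lemma smooth_along_scale U (a : P -> R^o) V :
  continuous f -> open U -> smooth_fun U a -> smooth_along f U V ->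
  smooth_along f U (fun q => a q *: V q).
Proof.
move=> cf oU sa sV; apply/(smooth_alongP _ cf oU) => d p ad Up dp.
have ld := near_chart_linear cf ad dp.
apply: (@near_eq_smooth_at _ _ _ _ _ (fun q => a q *: dir (f q) (V q) d)).
  near=> q; have lq : linear (fun v => dir (f q) v d) by near: q.
  pose lM := GRing.isLinear.Build _ _ _ _ _ lq.
  pose L : {linear _ -> _} := HB.pack (fun v => dir (f q) v d) lM.
  by rewrite -[RHS]/(L _) linearZ.
apply: smooth_at_scale; first exact: ((smooth_funP _ oU).1 sa).
exact: ((smooth_alongP _ cf oU).1 sV).
Unshelve. all: by end_near. Qed.

(** The empty sum is the zero section, which the Leibniz rule for the zero
    function shows to be parallel. *)
Lemma connection_along_sum D U k (V : 'I_k -> P -> 'rV[R]_n) p v :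
  continuous f -> connection_along f D -> open U -> U p ->
  (forall i, smooth_along f U (V i)) ->
  D p v (fun q => \sum_(i < k) V i q) = \sum_(i < k) D p v (V i).
Proof.
move=> cf [_ DD Ds _ _] oU Up; elim: k V => [|k IHk] V sV.
  have s0 := smooth_along_sum cf oU sV.
  have z0 : smooth_fun U (fun=> 0 : R^o).
    by apply/(smooth_funP _ oU) => q _; exact: smooth_at_cst.
  have := Ds _ _ _ _ v oU Up z0 s0; rewrite big_ord0 scale0r addr0.
  have -> : (fun q => 0 *: \sum_(i < 0) V i q) = fun q => \sum_(i < 0) V i q.
    by apply/funext => q; rewrite big_ord0 scaler0.
  by move=> ->; rewrite big_ord0 scaler0.
rewrite big_ord_recr /= -IHk // -(DD _ _ _ _ _ oU Up) //.
  by congr (D p v _); apply/funext => q; rewrite big_ord_recr.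
exact: smooth_along_sum.
Qed.

End sections_along.

(** * Smooth vector fields and their transport by a map *)
Section fields.
Variables (R : realType) (n : nat) (M : manifold R n).
Implicit Types (p q : M) (U : set M) (X : M -> 'rV[R]_n).

Lemma continuous_idfun : continuous (id : M -> M).
Proof. by move=> p; exact: cvg_id. Qed.

Lemma smooth_vf_coord_field (c : chart R n M) w :
  @atlas R n M c -> smooth_vf (chart_dom c) (coord_field c w).
Proof.
move=> ac.
apply/(smooth_alongP _ continuous_idfun (chart_dom_open c)) => d p ad cp dp.
have nc := near_chart_dom cp; have nd := near_chart_dom dp.
apply: (@near_eq_smooth_at _ _ _ _ _
  (fun q => 'D_w (d \o chart_inv c) (c q))).
  near=> q; rewrite dir_coord_field //; first by near: q.
  by apply: smooth_at_chart_fun => //; near: q.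
by apply: smooth_at_pderive => //; exact: smooth_at_chart_fun.
Unshelve. all: by end_near. Qed.

(** In coordinates [X u] is [\sum_j X_j *: D_j u]. *)
Lemma smooth_at_dir (V : normedModType R) U X p (u : M -> V) :
  open U -> smooth_vf U X -> U p -> (\forall q \near p, smooth_at q u) ->
  smooth_at p (fun q => dir q (X q) u).
Proof.
move=> oU sX Up su; pose c := chart_at p.
have ac : @atlas R n M c := chart_at_atlas p.
have cp : chart_dom c p := chart_at_dom p.
have nc := near_chart_dom cp.
apply: (@near_eq_smooth_at _ _ _ _ _ (fun q =>
  \sum_(j < n) dir q (X q) c 0 j *: 'D_(delta_mx 0 j) (u \o chart_inv c) (c q))).
  near=> q; have cq : chart_dom c q by near: q.
  have sq : smooth_at q u by near: q.
  rewrite (dir_chart _ ac cq sq) [RHS]derive_coord //.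
  exact: smooth_at_differentiable ac cq sq.
apply: smooth_at_sum => j; apply: smooth_at_scale.
  apply: smooth_at_coord.
  exact: ((smooth_alongP _ continuous_idfun oU).1 sX).
by apply: smooth_at_pderive => //; exact: nbhs_singleton su.
Unshelve. all: by end_near. Qed.

End fields.

Section transport.
Variables (R : realType) (m n : nat) (P : manifold R m) (Q : manifold R n).
Variable f : P -> Q.
Hypothesis sf : smooth_map f.

Lemma smooth_along_comp (U : set P) (W : set Q) (Y : Q -> 'rV[R]_n) :
  open U -> open W -> U `<=` f @^-1` W -> smooth_vf W Y ->
  smooth_along f U (Y \o f).
Proof.
move=> oU oW UW sY; apply/(smooth_alongP _ sf.1 oU) => d p ad /UW Wp dp.
apply: (smooth_at_comp sf (u := fun y => dir y (Y y) d)).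
exact: ((smooth_alongP _ (@continuous_idfun _ _ Q) oW).1 sY).
Qed.

(** In a chart [d] of the target, [f_* X] has the components [X (d \o f)]. *)
Lemma smooth_along_tmap (U : set P) (X : P -> 'rV[R]_m) :
  open U -> smooth_vf U X -> smooth_along f U (fun q => tmap f q (X q)).
Proof.
move=> oU sX; apply/(smooth_alongP _ sf.1 oU) => d p ad Up dp.
have nd : \forall q \near p, chart_dom d (f q).
  exact: near_preimage (near_chart_dom dp).
apply: (@near_eq_smooth_at _ _ _ _ _ (fun q => dir q (X q) (d \o f))).
  near=> q; rewrite dir_tmap //; apply: smooth_at_chart_fun => //.
  by near: q.
apply: (smooth_at_dir oU sX Up); near=> q.
by apply: smooth_at_chart_comp => //; near: q.
Unshelve. all: by end_near. Qed.

End transport.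

(** * Bilinear and linear forms *)

Section forms.
Variables (R : realType) (n : nat) (M : manifold R n).
Variables (g : M -> 'M[R]_n) (eta : M -> 'cV[R]_n).
Implicit Types (p : M) (u v w : 'rV[R]_n).

Lemma form2Dl p u v w : form2 g p (u + v) w = form2 g p u w + form2 g p v w.
Proof. by rewrite /form2 !mulmxDl mxE. Qed.

Lemma form2Zl p a u w : form2 g p (a *: u) w = a * form2 g p u w.
Proof. by rewrite /form2 -!scalemxAl mxE. Qed.

Lemma form2_suml p k (u : 'I_k -> 'rV[R]_n) w :
  form2 g p (\sum_(i < k) u i) w = \sum_(i < k) form2 g p (u i) w.
Proof. by rewrite /form2 !mulmx_suml summxE. Qed.

Lemma form2Nl p u w : form2 g p (- u) w = - form2 g p u w.
Proof. by rewrite -scaleN1r form2Zl mulN1r. Qed.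

Lemma form2_sym p u w : (g p)^T = g p -> form2 g p u w = form2 g p w u.
Proof.
move=> gT; rewrite /form2.
have -> : w *m g p *m u^T = (u *m g p *m w^T)^T.
  by rewrite !trmx_mul trmxK gT mulmxA.
by rewrite [RHS]mxE.
Qed.

Lemma form1_linear p : linear (form1 eta p : 'rV[R]_n -> R^o).
Proof. by move=> a u v; rewrite /form1 mulmxDl -scalemxAl !mxE. Qed.

Lemma form1Z p a u : form1 eta p (a *: u) = a * form1 eta p u.
Proof. by rewrite /form1 -scalemxAl mxE. Qed.

Lemma form1_0 p : form1 eta p 0 = 0.
Proof. by rewrite /form1 mul0mx mxE. Qed.

End forms.

(** * Metric compatibility of the pullback connection *)

(** Over a neighbourhood of [p], write [V = \sum_j a_j *: (E_j \o f)] with [E_j]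
    the coordinate fields of a chart around [f p].  Both sides then become
    [\sum_j (v(a_j) <E_j, Y> + a_j v(<E_j, Y> \o f))]: the left one by the Leibniz
    rule for functions, the right one by the Leibniz rule for [D] and the metric
    property of [nabla], since [v(b \o f) = (f_* v)(b)]. *)
Lemma pullback_connection_metric (R : realType) (m n : nat)
    (P : manifold R m) (Q : manifold R n) (f : P -> Q) (g : Q -> 'M[R]_n)
    (nabla : Q -> 'rV[R]_n -> (Q -> 'rV[R]_n) -> 'rV[R]_n)
    (D : P -> 'rV[R]_m -> (P -> 'rV[R]_n) -> 'rV[R]_n)
    (U : set P) (W : set Q) (V : P -> 'rV[R]_n) (Y : Q -> 'rV[R]_n)
    (p : P) (v : 'rV[R]_m) :
  smooth_map f -> smooth_form2 g -> metric_connection g nabla ->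
  pullback_connection f nabla D ->
  open U -> U p -> smooth_along f U V ->
  open W -> W (f p) -> smooth_vf W Y ->
  dir p v (fun q => form2 g (f q) (V q) (Y (f q)) : R^o) =
    form2 g (f p) (D p v V) (Y (f p)) +
    form2 g (f p) (V p) (nabla (f p) (tmap f p v) Y).
Proof.
move=> sf sg mn [cD pD] oU Up sV oW Wp sY.
pose c := chart_at (f p); have ac : @atlas R n Q c := chart_at_atlas (f p).
have cp : chart_dom c (f p) := chart_at_dom (f p).
have oc := chart_dom_open c.
pose W0 := W `&` chart_dom c; have oW0 : open W0 by exact: openI.
have W0p : W0 (f p) by [].
pose U0 := U `&` f @^-1` W0.
have oU0 : open U0 by apply: openI => //; exact: open_preimage.
have U0p : U0 p by [].
pose E j := coord_field c (delta_mx 0 j) : Q -> 'rV[R]_n.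
pose a j q := dir (f q) (V q) c 0 j : R^o.
pose b j y := form2 g y (E j y) (Y y) : R^o.
have id_cont := @continuous_idfun _ _ Q.
have sE j : smooth_vf W0 (E j).
  apply: (smooth_along_subset id_cont oc oW0); first by move=> y [].
  exact: smooth_vf_coord_field.
have sY0 : smooth_vf W0 Y.
  by apply: (smooth_along_subset id_cont oW oW0) => // y [].
have sb j : smooth_at (f p) (b j).
  by apply: ((smooth_funP _ oW0).1 (sg _ _ _ oW0 (sE j) sY0)).
have sa j : smooth_fun U0 (a j).
  apply/(smooth_funP _ oU0) => q [Uq [_ cq]].
  apply: smooth_at_coord.
  exact: ((smooth_alongP _ sf.1 oU).1 sV).
have sap j : smooth_at p (a j) by apply: ((smooth_funP _ oU0).1 (sa j)).
have sEf j : smooth_along f U0 (E j \o f).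
  by apply: (smooth_along_comp sf oU0 oW0 _ (sE j)) => q [].
have saE j : smooth_along f U0 (fun q => a j q *: (E j \o f) q).
  exact: smooth_along_scale (sf.1) oU0 (sa j) (sEf j).
have VE q : U0 q -> V q = \sum_(j < n) a j q *: (E j \o f) q.
  by move=> [_ [_ cq]]; exact: coord_field_expand.
have nU0 : \forall q \near p, U0 q by apply: open_nbhs_nbhs.
have -> : dir p v (fun q => form2 g (f q) (V q) (Y (f q)) : R^o) =
    \sum_(j < n) (dir p v (a j) * b j (f p) + a j p * dir p v (b j \o f)).
  rewrite (@near_eq_dir _ _ _ _ _ _ _
    (fun q => \sum_(j < n) a j q *: (b j \o f) q)); last first.
    near=> q; have U0q : U0 q by near: q.
    rewrite {1}(VE q U0q) form2_suml; apply: eq_bigr => j _.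
    by rewrite form2Zl.
  rewrite dir_sum => [|j].
    apply: eq_bigr => j _; rewrite dir_scale //.
    exact: smooth_at_comp.
  by apply: smooth_at_scale => //; exact: smooth_at_comp.
have -> : D p v V = \sum_(j < n)
    (dir p v (a j) *: E j (f p) + a j p *: nabla (f p) (tmap f p v) (E j)).
  have [_ _ Ds De _] := cD.
  have sV0 : smooth_along f U0 V.
    by apply: (smooth_along_subset sf.1 oU oU0) => // q [].
  rewrite (De _ _ _ _ v oU0 U0p sV0 VE).
  rewrite (connection_along_sum v sf.1 cD oU0 U0p saE).
  apply: eq_bigr => j _; rewrite (Ds _ _ _ _ v oU0 U0p (sa j) (sEf j)).
  by rewrite (pD _ _ _ v oW0 W0p (sE j)).
rewrite [in RHS](VE p U0p) !form2_suml -big_split; apply: eq_bigr => j _ /=.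
rewrite form2Dl !form2Zl -addrA -mulrDr -(mn _ _ _ _ _ oW0 W0p (sE j) sY0).
by rewrite -dir_tmap.
Unshelve. all: by end_near. Qed.

(** * Almost paracontact and para-Sasakian identities *)
Section paracontact.
Variables (R : realType) (n : nat) (M : manifold R (2 * n + 1)).
Variables (phi : M -> 'M[R]_(2 * n + 1)) (xi : M -> 'rV[R]_(2 * n + 1)).
Variables (eta : M -> 'cV[R]_(2 * n + 1)) (g : M -> 'M[R]_(2 * n + 1)).
Hypothesis pc : almost_paracontact_metric phi xi eta g.
Implicit Types (p : M) (u v w : 'rV[R]_(2 * n + 1)).

Lemma paracontact_phi2 p v :
  v *m phi p *m phi p = v - form1 eta p v *: xi p.
Proof.
case: pc => _ [phi2 _] _ _ _.
by rewrite -mulmxA phi2 mulmxBr mulmx1 mulmxA [v *m _]mx11_scalar mul_scalar_mx.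
Qed.

(** [phi^2 xi = 0], so [phi^2] kills [phi xi]; hence [phi xi] is a multiple
    [c xi] of [xi].  Then [0 = phi^2 xi = c^2 xi] forces [c = 0]. *)
Lemma paracontact_xi_phi p : xi p *m phi p = 0.
Proof.
case: (pc) => _ [_ eta_xi] _ _ _.
have xi2 : xi p *m phi p *m phi p = 0.
  by rewrite paracontact_phi2 eta_xi scale1r subrr.
have := paracontact_phi2 p (xi p *m phi p); rewrite xi2 mul0mx => /eqP.
rewrite eq_sym subr_eq0 => /eqP xi_phi.
move: xi_phi; set c := form1 eta p _ => xi_phi.
move: xi2; rewrite xi_phi -scalemxAl xi_phi scalerA.
move=> /(congr1 (form1 eta p)); rewrite form1Z form1_0 eta_xi mulr1 => /eqP.
by rewrite mulf_eq0 orbb => /eqP ->; rewrite scale0r.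
Qed.

(** Compare the two evaluations [phi^2 (phi v) = phi v - eta(phi v) xi] and
    [phi (phi^2 v) = phi v - eta(v) phi xi = phi v]. *)
Lemma paracontact_eta_phi p v : form1 eta p (v *m phi p) = 0.
Proof.
case: (pc) => _ [_ eta_xi] _ _ _.
have := paracontact_phi2 p (v *m phi p).
rewrite [v *m phi p *m phi p]paracontact_phi2 mulmxBl -scalemxAl.
rewrite paracontact_xi_phi scaler0 subr0 => /eqP.
rewrite -subr_eq0 subKr => /eqP /(congr1 (form1 eta p)).
by rewrite form1Z form1_0 eta_xi mulr1.
Qed.

Lemma paracontact_form2_xi p v : form2 g p v (xi p) = form1 eta p v.
Proof.
case: (pc) => _ [_ eta_xi] _ _ gphi.
have /eqP := gphi p v (xi p).
rewrite paracontact_xi_phi eta_xi mulr1 {1}/form2 trmx0 mulmx0 mxE.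
by rewrite eq_sym addrC subr_eq0 => /eqP.
Qed.

(** Compatibility of [g] with [phi], applied to [phi v] and [v], makes
    [<phi v, v>] its own opposite. *)
Lemma paracontact_form2_phi p v : form2 g p (v *m phi p) v = 0.
Proof.
case: (pc) => [[_ _ _ [_ gT]]] _ _ _ gphi.
have := gphi p (v *m phi p) v.
rewrite paracontact_phi2 paracontact_eta_phi mul0r addr0 form2Dl form2Nl form2Zl.
rewrite (form2_sym (xi p)) ?(gT p).1 // paracontact_form2_xi.
rewrite paracontact_eta_phi mulr0 subr0.
rewrite (form2_sym v) ?(gT p).1 // => /eqP.
by rewrite -subr_eq0 opprK -mulr2n mulrn_eq0 => /eqP.
Qed.

(** The para-Sasakian identity for [Y = xi] reads
    [- phi (nabla_w xi) = - eta(w) xi + w], so a horizontal [w] is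
    [- phi (nabla_w xi)], which is orthogonal to [nabla_w xi] by skewness. *)
Lemma para_sasakian_nabla_xi nabla p w :
  para_sasakian phi xi eta g nabla -> form1 eta p w = 0 ->
  form2 g p w (nabla p w xi) = 0.
Proof.
move=> [_ [cn _ _] sas] etaw.
case: (pc) => [[_ sxi _ _] [_ eta_xi] _ _ _].
(* The identity is about fields, so [w] is extended to the field [X] with
   constant components. *)
pose c := chart_at p; have ac : @atlas R _ M c := chart_at_atlas p.
have cp : chart_dom c p := chart_at_dom p.
pose X := coord_field c (dir p w c).
have Xp : X p = w by exact: coord_field_dir.
have sX : smooth_vf (chart_dom c) X by exact: smooth_vf_coord_field.
have id_cont := @continuous_idfun _ _ M.
have sxi' : smooth_vf (chart_dom c) xi.
  exact: (smooth_along_subset id_cont openT (chart_dom_open c)).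
have := sas _ _ _ _ (chart_dom_open c) cp sX sxi'.
(* Writing the zero field [phi xi] as [0 *: xi] lets the Leibniz rule compute
   its covariant derivative. *)
have -> : (fun q => xi q *m phi q) = fun q => 0 *: xi q.
  by apply/funext => q; rewrite paracontact_xi_phi scale0r.
have [_ _ cs _ _] := cn.
have z0 : smooth_fun (chart_dom c) (fun=> 0 : R^o).
  by apply/(smooth_funP _ (chart_dom_open c)) => q _; exact: smooth_at_cst.
rewrite (cs _ (fun=> 0) _ _ _ (chart_dom_open c) cp z0 sxi').
rewrite Xp paracontact_form2_xi etaw eta_xi !scale0r scale1r oppr0 add0r addr0.
have -> : dir p w (fun=> 0 : R^o) = 0 by rewrite /dir derive_cst.
rewrite scale0r sub0r => e; rewrite -[X in form2 g p X]e form2Nl.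
by rewrite paracontact_form2_phi oppr0.
Qed.

End paracontact.

(** * The tension field of a paraholomorphic map *)

Theorem theorem3p5 (R : realType) (m n1 : nat)
    (N : manifold R (2 * m)) (J h : N -> 'M[R]_(2 * m))
    (nablaN : N -> 'rV[R]_(2 * m) -> (N -> 'rV[R]_(2 * m)) -> 'rV[R]_(2 * m))
    (M1 : manifold R (2 * n1 + 1)) (phi1 : M1 -> 'M[R]_(2 * n1 + 1))
    (xi1 : M1 -> 'rV[R]_(2 * n1 + 1)) (eta1 : M1 -> 'cV[R]_(2 * n1 + 1))
    (g1 : M1 -> 'M[R]_(2 * n1 + 1))
    (nablaM : M1 -> 'rV[R]_(2 * n1 + 1) -> (M1 -> 'rV[R]_(2 * n1 + 1)) ->
              'rV[R]_(2 * n1 + 1))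
    (f : N -> M1)
    (nablaf : N -> 'rV[R]_(2 * m) -> (N -> 'rV[R]_(2 * n1 + 1)) ->
              'rV[R]_(2 * n1 + 1))
    (tau : N -> 'rV[R]_(2 * n1 + 1)) :
  almost_para_hermitian J h ->
  levi_civita h nablaN ->
  para_sasakian phi1 xi1 eta1 g1 nablaM ->
  smooth_map f ->
  paraholomorphic J phi1 f ->
  pullback_connection f nablaM nablaf ->
  tension_field f h nablaN nablaf tau ->
  forall p : N, ker_distribution eta1 (f p) (tau p).
Proof.
move=> [_ _ J2 _ _] _ ps sf ph pD tens p.
have [pc [cn _ mn] _] := ps; have [[_ sxi _ [sg _]] _ _ _ _] := pc.
have eta_tmap q v : form1 eta1 (f q) (tmap f q v) = 0.
  by rewrite -[v]mulmx1 -(J2 q) mulmxA ph (paracontact_eta_phi pc).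
have [U [e [oU Up [se _] tauE]]] := tens p.
rewrite /ker_distribution /= tauE //.
pose L := form1 eta1 (f p) : 'rV[R]_(2 * n1 + 1) -> R^o.
pose lM := GRing.isLinear.Build _ _ _ _ L (form1_linear eta1 (f p)).
pose etaL : {linear _ -> _} := HB.pack L lM.
rewrite -[LHS]/(etaL _) linear_sum big1 // => i _.
rewrite linearZ linearB /= [L (tmap f p _)]eta_tmap subr0.
(* [eta1] of the [i]-th term is now that of [D_{e_i} (f_* e_i)], which
   differentiating the constant [<f_* e_i, xi1>] evaluates. *)
have := pullback_connection_metric (e i p) sf sg mn pD oU Up
  (smooth_along_tmap sf oU (se i)) openT I sxi.
rewrite (paracontact_form2_xi pc) (para_sasakian_nabla_xi pc ps (eta_tmap _ _)).
rewrite addr0 -/L => <-.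
rewrite (_ : (fun _ => _) = fun=> 0); last first.
  by apply/funext => q; rewrite (paracontact_form2_xi pc) eta_tmap.
by rewrite /dir derive_cst scaler0.
Qed.
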